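(* For every $n\ge 1$ the genus distribution of ${\cal S}_3^n$ is unimodal, and its peak $p_3(n)$ is $$p_3(n)=\begin{cases}\Big[\dfrac{n-1}{2}\Big], & 1\le n\le 6,\\[2mm] 2, & n=7,\\[1mm] \Big[\dfrac{n+2}{3}\Big], & n\ge 8.\end{cases}$$
   Context: $[x]$ denotes the largest integer not exceeding $x$. A surface is represented by a cyclic word in which every occurring letter $x$ appears exactly once as $x$ and exactly once as $x^-$; it is the closed orientable surface obtained from a polygon with boundary labelled by the word by identifying each side $x$ with the side $x^-$ (orientation reversed), and its genus is the genus of that surface. Let $a_1,a_2,\dots$ be distinct letters. For $n\ge 1$ and subsets $K,T\subseteq\{1,\dots,n\}$ put: $R_1^n$ = product of the letters $a_k$, $k\in K$, in decreasing order of index; $R_2^n$ = product of the $a_k$, $k\notin K$, in increasing order of index; $R_3^n$ = product of the $a_t^-$, $t\in T$, in decreasing order of index; $R_4^n$ = product of the $a_t^-$, $t\notin T$, in increasing order of index. The set of ladder surfaces considered is ${\cal S}_3^n=\{R_1^nR_3^nR_2^nR_4^n\}$, where $(K,T)$ runs over all $4^n$ pairs of subsets and surfaces are counted with multiplicity (one for each pair). $g_{i_3}(n)$ is the number of surfaces of genus $i$ in ${\cal S}_3^n$, and the genus distribution of ${\cal S}_3^n$ is the sequence $(g_{i_3}(n))_i$, with $i$ running from the minimum to the maximum genus of surfaces in ${\cal S}_3^n$. A finite sequence of nonnegative numbers $\{a_i\}_{i=q}^n$ is unimodal if $a_q\le\cdots\le a_{l-1}<a_l=\cdots=a_m>a_{m+1}\ge\cdots\ge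 a_n$ for some $q\le l\le m\le n$; $l,\dots,m$ are its modes, and if $l=m$ then $m$ is called the peak (indices are genera). *)

(* Defs.v *)
From mathcomp Require Import all_boot all_order all_algebra.

Set Implicit Arguments.
Unset Strict Implicit.
Unset Printing Implicit Defensive.

Import GRing.Theory.

(* A word is a sequence of signed letters: (x, false) stands for x and        *)
(* (x, true) for x^-.                                                         *)

Section Surface.
Variable L : eqType.
Implicit Type w : seq (L * bool).

Definition surface_word w : bool :=
  uniq w && all (fun s => (s.1, ~~ s.2) \in w) w.

Definition side w (i : 'I_(size w)) : L * bool := tnth (in_tuple w) i.

Definition glued w : rel 'I_(size w) := fun i j =>
  ((side i).1 == (side j).1) && ((side i).2 != (side j).2).

(* The polygon has vertices 'I_(size w), and its side i runs from vertex i to *)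
(* vertex i + 1 (cyclically). Gluing side i to side j with reversed           *)
(* orientation identifies i with j + 1 and i + 1 with j.                      *)
Definition vertex_glued w : rel 'I_(size w) := fun u v =>
  [exists i, exists j, glued i j &&
    (((u == i) && (v == ordS j)) || ((u == ordS i) && (v == j)))].

Lemma vertex_glued_sym w : symmetric (@vertex_glued w).
Proof.
suff H u v : @vertex_glued w u v -> vertex_glued v u.
  by move=> u v; apply/idP/idP; apply: H.
case/existsP=> i /existsP[j /andP[gij h]].
apply/existsP; exists j; apply/existsP; exists i.
rewrite /glued eq_sym [_.2 == _]eq_sym -/(glued i j) gij /=.
by case/orP: h => /andP[-> ->]; rewrite ?orbT.
Qed.

Definition num_vertices w : nat := n_comp (@vertex_glued w) 'I_(size w).

(* V - E + F for the induced cell structure: the sides are identified in      *)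
(* pairs and the polygon is the only face.                                    *)
Definition euler_char w : int :=
  ((num_vertices w)%:Z - ((size w)./2)%:Z + 1)%R.

Definition has_genus w (g : nat) : bool :=
  (euler_char w == 2 - 2 * g%:Z)%R.

End Surface.

Section Ladder.
Variable n : nat.
Implicit Types K T : {set 'I_n}.

(* The letter a_k is represented by k - 1 : 'I_n; [enum] lists a set of       *)
(* ordinals in increasing order.                                              *)
Definition R1 K : seq ('I_n * bool) := [seq (k, false) | k <- rev (enum K)].
Definition R2 K : seq ('I_n * bool) := [seq (k, false) | k <- enum (~: K)].
Definition R3 T : seq ('I_n * bool) := [seq (t, true) | t <- rev (enum T)].
Definition R4 T : seq ('I_n * bool) := [seq (t, true) | t <- enum (~: T)].

Definition ladder_word K T : seq ('I_n * bool) := R1 K ++ R3 T ++ R2 K ++ R4 T.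

Lemma mem_ladder_word K T s : s \in ladder_word K T.
Proof.
have inj b : injective (fun k : 'I_n => (k, b)) by move=> x y [].
have H b (x : 'I_n) e : x \in e -> (x, b) \in [seq (k, b) | k <- e].
  by move=> xe; apply/mapP; exists x.
case: s => x [].
  have [xT | xT] := boolP (x \in T); rewrite !mem_cat.
    by rewrite [_ \in R3 T]H ?orbT // mem_rev mem_enum.
  by rewrite [_ \in R4 T]H ?orbT // mem_enum inE.
have [xK | xK] := boolP (x \in K); rewrite !mem_cat.
  by rewrite [_ \in R1 K]H // mem_rev mem_enum.
by rewrite [_ \in R2 K]H ?orbT // mem_enum inE.
Qed.

Lemma size_ladder_word K T : size (ladder_word K T) = n.*2.
Proof.
rewrite /ladder_word !size_cat /R1 /R2 /R3 /R4 !size_map !size_rev -!cardE.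
by rewrite addnA addnACA !cardsC card_ord addnn.
Qed.

Lemma surface_ladder_word K T : surface_word (ladder_word K T).
Proof.
apply/andP; split; last by apply/allP => s _; apply: mem_ladder_word.
apply/card_uniqP; rewrite size_ladder_word.
rewrite (eq_card (B := predT)); last by move=> s; rewrite mem_ladder_word.
by rewrite card_prod card_bool card_ord muln2.
Qed.

Definition genus_count (i : nat) : nat :=
  #|[set KT : {set 'I_n} * {set 'I_n} | has_genus (ladder_word KT.1 KT.2) i]|.

Definition is_min_genus (q : nat) : Prop :=
  (exists K T, has_genus (ladder_word K T) q) /\
  (forall K T g, has_genus (ladder_word K T) g -> q <= g).

Definition is_max_genus (r : nat) : Prop :=
  (exists K T, has_genus (ladder_word K T) r) /\
  (forall K T g, has_genus (ladder_word K T) g -> g <= r).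

End Ladder.

(* For the finite sequence a_q, ..., a_r:                                     *)
(*   a_q <= ... <= a_(l-1) < a_l = ... = a_m > a_(m+1) >= ... >= a_r.         *)
Record modes (a : nat -> nat) (q r l m : nat) : Prop := Modes {
  modes_range : q <= l <= m /\ m <= r;
  modes_nondecr : forall i, q <= i -> i.+1 < l -> a i <= a i.+1;
  modes_left : q < l -> a l.-1 < a l;
  modes_plateau : forall i, l <= i <= m -> a i = a l;
  modes_right : m < r -> a m.+1 < a m;
  modes_nonincr : forall i, m < i -> i < r -> a i.+1 <= a i
}.

Definition unimodal (a : nat -> nat) (q r : nat) : Prop :=
  exists l m, modes a q r l m.

Definition is_peak (a : nat -> nat) (q r p : nat) : Prop := modes a q r p p.

Definition p3 (n : nat) : nat :=
  if n <= 6 then (n - 1) %/ 2 else if n == 7 then 2 else (n + 2) %/ 3.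

(* Main.v *)
(* Add three markers to the cyclic word of a ladder surface:                   *)
(*   M0 R1 M1 R3 R2 M2 R4.                                                     *)
(* The vertices of the surface are the cycles of phi = (next letter) o         *)
(* (partner), and the letters a_n, a_n^- with the largest index are inserted   *)
(* right next to markers. Hence all that matters about phi is the first return *)
(* permutation it induces on the markers, one of six, and the two bits         *)
(* (n \in K, n \in T) determine the new one and whether the genus grows.       *)
(* In generating functions the resulting recurrences solve explicitly: up to   *)
(* lower terms the i-th coefficient is 2^(n+i) 'C(n - i, i), which stems from  *)
(* h_(n+1) = 2 h_n + 8 z h_(n-1), together with 8^i 'C(n - i, i), which stems  *)
(* from f_(n+1) = f_n + 8 z f_(n-1). The first family has its mode at          *)
(* [(n + 2) / 3] by a polynomial inequality. The second one increases up to    *)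
(* there; beyond, either it decreases too, or n <= 5 (n - 2 i) and it is       *)
(* dominated by the factor 2^(n - 2 i) of the first. This leaves n < 45, which *)
(* is checked by computation.                                                  *)

Require Import Defs.
From Stdlib Require Import NArith.
From mathcomp Require Import all_boot all_order all_algebra all_fingroup.
From mathcomp Require Import zify.

Set Implicit Arguments.
Unset Strict Implicit.
Unset Printing Implicit Defensive.

(** * Words and cycles of permutations *)

(** The vertices of the glued polygon are the cycles of [flip * wcyc w] ([num_vertices_ncyc]), so V
    + 2g = n + 1 turns the genus into a cycle count. A letter not yet used forms a 2-cycle with its
    inverse. Splicing that 2-cycle into two corners keeps the number of cycles if the corners lie on
    a common cycle and lowers it by 2 otherwise ([ncyc_splice]), so exactly in the second case the
    genus grows by one. Which case occurs depends only on the permutation induced on the three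
    markers ([tracks_step], [phi_run]). Hence the genus is computed by a six-state automaton reading
    the n pairs of bits ([step_transition]), and the counts by state and genus obey a linear
    recurrence ([state_countS]).

    Its solution ([closed_formsP], [genus_countE]) says for n + 1 letters, with u_i = [ucoef n i],
    that 4 g_i = (2^(n+2+i) - 8^i) u_i + 8^(i+1) u_(i+1) + 2 [i = 0]. The leading part rises or
    falls according to whether 2 u_(i+1) or u_i is larger. Ratios of binomials show that the change
    happens at 3i = n + 1 ([ucoef_incr], [ucoef_decr]). The remaining terms are controlled in
    [genus_count_incr] and [genus_count_decr] for large n, and the first 44 rows are computed
    exactly. Every comparison obtained is strict on the genus range from 0 to n/2, so the mode is
    unique. *)

Section Cycles.
Local Open Scope group_scope.
Variable T : finType.
Implicit Types (s t : {perm T}) (w : seq T) (x y z : T).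

Definition ncyc s : nat := #|porbits s|.

Lemma ncycV s : ncyc s^-1 = ncyc s.
Proof. by rewrite /ncyc porbitsV. Qed.

Lemma ncyc_tpermM x y s :
  ncyc (tperm x y * s) + (x \notin porbit s y).*2 = ncyc s + (x != y).
Proof. exact: porbits_mul_tperm. Qed.

Lemma ncyc_Mtperm x y s :
  ncyc (s * tperm x y) + (x \notin porbit s y).*2 = ncyc s + (x != y).
Proof.
by rewrite -(ncycV (s * _)) invMg tpermV -(ncycV s) -(porbitV s) ncyc_tpermM.
Qed.

Lemma ncyc1 : ncyc 1 = #|T|.
Proof.
rewrite /ncyc /porbits card_imset // => x y /eqP.
by rewrite eq_porbit_mem porbit.unlock cycle1 imset_set1 /aperm perm1 inE => /eqP.
Qed.

Lemma perm_in_porbit s x : s x \in porbit s x.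
Proof. exact: (mem_porbit s 1). Qed.

Lemma eq_porbit_perm s x : porbit s (s x) = porbit s x.
Proof. by apply/eqP; rewrite eq_porbit_mem perm_in_porbit. Qed.

Lemma mem_porbit_perml s x y : (s x \in porbit s y) = (x \in porbit s y).
Proof. by rewrite -!eq_porbit_mem eq_porbit_perm. Qed.

Lemma mem_porbit_permr s x y : (x \in porbit s (s y)) = (x \in porbit s y).
Proof. by rewrite eq_porbit_perm. Qed.

Lemma porbit_fixed s x y : s x = x -> (y \in porbit s x) = (y == x).
Proof.
move=> sx; apply/porbitP/eqP => [[i ->]|->]; last by exists 0; rewrite perm1.
by rewrite permX iter_fix.
Qed.

Lemma porbit_stable s (P : pred T) x y :
  (forall z, P z -> P (s z)) -> y \in porbit s x -> P x -> P y.
Proof.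
move=> Ps /porbitP[i ->] Px; rewrite permX.
by elim: i => //= i; apply: Ps.
Qed.

(** The first transposition merges the 2-cycle into the cycle of [y]. Now [x'] lies on that cycle,
    so the second transposition splits it if [z] is there too, and merges two cycles otherwise. *)
Lemma ncyc_splice s x x' y z :
    s x = x' -> s x' = x -> x != x' -> y \notin [:: x; x'] ->
    z \notin [:: x; x'] ->
  ncyc (s * tperm x y * tperm x' z) + (y \notin porbit s z).*2 = ncyc s.
Proof.
move=> sx sx' nxx; rewrite !inE !negb_or => /andP[yx yx'] /andP[zx zx'].
have splice1 (r : {perm T}) u : r x = x' -> r x' = x -> u != x -> u != x' ->
    ncyc (r * tperm x u) + 1 = ncyc r.
  move=> rx rx' ux ux'; have := ncyc_Mtperm x u r.
  suff -> : x \notin porbit r u by rewrite eq_sym ux; lia.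
  apply/negP => xu.
  have /orP[] : (x == u) || (x' == u); last by rewrite eq_sym (negPf ux').
    rewrite porbit_sym in xu.
    have := @porbit_stable r (fun v => (x == v) || (x' == v)) x u.
    apply=> //; last by rewrite eqxx.
    by move=> v /orP[]/eqP<-; rewrite ?rx ?rx' eqxx ?orbT.
  by rewrite eq_sym (negPf ux).
set s1 := s * tperm x y.
have c1 : ncyc s1 + 1 = ncyc s by apply: splice1.
have x'y u : (x' \in porbit s1 u) = (y \in porbit s1 u).
  by rewrite -(mem_porbit_perml s1) permM sx' tpermL.
(* For distinct points, multiplying by [tperm y z] raises the cycle count exactly when [y] and [z]
   share a cycle. Splicing in the 2-cycle lowers the counts of both [s] and [s * tperm y z] by one,
   so the answer is the same for [s1]. *)
have yz_s1 : (y \in porbit s1 z) = (y \in porbit s z).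
  have [->|yz] := eqVneq y z; first by rewrite !porbit_id.
  have := ncyc_Mtperm y z s; have := ncyc_Mtperm y z s1.
  suff : ncyc (s1 * tperm y z) + 1 = ncyc (s * tperm y z).
    by rewrite yz; case: (y \in _); case: (y \in _) => //=; lia.
  have -> : s1 * tperm y z = s * tperm y z * tperm x z.
    rewrite /s1 -!mulgA; congr (_ * _).
    apply/permP => u; rewrite !permM.
    have [->|ux] := eqVneq u x.
      by rewrite tpermL (tpermD _ _ (z := x)) // ?tpermL // eq_sym.
    have [->|uy] := eqVneq u y.
      by rewrite tpermR (tpermD _ _ (z := x)) ?tpermL ?tpermR // eq_sym.
    have [->|uz] := eqVneq u z.
      by rewrite (tpermD _ _ (z := z)) ?tpermR ?(tpermD _ _ (z := y)) // eq_sym.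
    by rewrite !tpermD // eq_sym.
  by apply: splice1; rewrite ?permM ?sx ?sx' ?tpermD // eq_sym.
by have := ncyc_Mtperm x' z s1; rewrite x'y yz_s1 (eq_sym x') zx'; lia.
Qed.

(** Successor in the cyclic word, built from transpositions so that inserting a letter is right
    multiplication by a single transposition. *)
Fixpoint wcyc w : {perm T} :=
  if w is x :: w' then wcyc w' * tperm x (head x w') else 1.

Lemma wcycE w : uniq w -> wcyc w =1 next w.
Proof.
elim: w => [|x [|y w] IH] Uw z; first by rewrite perm1.
  by rewrite /= tperm1 mul1g perm1; case: eqP.
have /andP[xN Uw'] := Uw.
rewrite [LHS]permM IH // [head _ _]/= !next_nth.
rewrite [z \in [:: x, y & w]]inE.
have [->|zx] := eqVneq z x; first by rewrite (negPf xN) tpermL /= eqxx.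
have -> : index z [:: x, y & w] = (index z (y :: w)).+1.
  by rewrite /= eq_sym (negPf zx).
rewrite orFb; case: ifP => zw; last first.
  by rewrite tpermD // eq_sym //; apply: contraFneq zw => ->; rewrite mem_head.
rewrite [RHS]/=; have [iw|iw] := ltnP (index z (y :: w)) (size w).
  rewrite (set_nth_default x) // tpermD //.
    apply: contraNneq xN => ->; rewrite inE mem_nth ?orbT //.
  by apply: contraTneq Uw' => ->; rewrite /= mem_nth.
by rewrite !nth_default // tpermR.
Qed.

Lemma wcyc_catC w1 w2 : uniq (w1 ++ w2) -> wcyc (w1 ++ w2) = wcyc (w2 ++ w1).
Proof.
move=> U; apply/permP=> x; rewrite !wcycE //; last by rewrite uniq_catC.
by rewrite -(rot_size_cat w1) next_rot.
Qed.

Lemma wcyc_insert w1 x w2 : uniq (w1 ++ x :: w2) ->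
  wcyc (w1 ++ x :: w2) = wcyc (w1 ++ w2) * tperm x (head x (w2 ++ w1)).
Proof.
move=> U; rewrite wcyc_catC //= wcyc_catC // uniq_catC.
by apply: subseq_uniq U; rewrite subseq_cat2l subseq_cons.
Qed.

Lemma wcyc_head w1 x w2 : uniq (w1 ++ x :: w2) ->
  wcyc (w1 ++ x :: w2) x = head x (w2 ++ w1).
Proof.
move=> U; rewrite wcyc_catC // wcycE; last by rewrite uniq_catC.
by rewrite cat_cons; case: (w2 ++ w1) => [|y w]; rewrite /= eqxx.
Qed.

Lemma wcyc_notin w x : uniq w -> x \notin w -> wcyc w x = x.
Proof. by move=> U xw; rewrite wcycE // next_nth (negPf xw). Qed.

End Cycles.

(** * First return permutations *)

Section SumPerm.
Local Open Scope group_scope.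
Variables A M : finType.
Implicit Types (s : {perm A}) (t : {perm M}).

Definition sum_fun s t (u : A + M) : A + M :=
  match u with inl a => inl (s a) | inr m => inr (t m) end.

Lemma sum_fun_inj s t : injective (sum_fun s t).
Proof. by case=> a [] b //= [] /perm_inj->. Qed.

Definition sum_perm s t : {perm A + M} := perm (@sum_fun_inj s t).

Lemma sum_permEl s t a : sum_perm s t (inl a) = inl (s a).
Proof. by rewrite permE. Qed.

Lemma sum_permEr s t m : sum_perm s t (inr m) = inr (t m).
Proof. by rewrite permE. Qed.

Definition sum_permE := (sum_permEl, sum_permEr).

Lemma sum_permM s s' t t' :
  sum_perm s t * sum_perm s' t' = sum_perm (s * s') (t * t').
Proof. by apply/permP=> -[a|m]; rewrite permM !sum_permE permM. Qed.

Lemma sum_perm11 : sum_perm 1 1 = 1.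
Proof. by apply/permP=> -[a|m]; rewrite sum_permE !perm1. Qed.

Lemma sum_perm_tperml a b : sum_perm (tperm a b) 1 = tperm (inl a) (inl b).
Proof.
apply/permP=> -[c|m]; rewrite sum_permE ?perm1; last by rewrite tpermD.
case: tpermP => [->|->|/eqP ca /eqP cb]; rewrite ?tpermL ?tpermR //.
by rewrite tpermD // (inj_eq (@inl_inj A M)) eq_sym.
Qed.

Lemma sum_perm_tpermr p q : sum_perm 1 (tperm p q) = tperm (inr p) (inr q).
Proof.
apply/permP=> -[c|m]; rewrite sum_permE ?perm1; first by rewrite tpermD.
case: tpermP => [->|->|/eqP ca /eqP cb]; rewrite ?tpermL ?tpermR //.
by rewrite tpermD // (inj_eq (@inr_inj A M)) eq_sym.
Qed.

Lemma sum_permX s t i : sum_perm s t ^+ i = sum_perm (s ^+ i) (t ^+ i).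
Proof. by elim: i => [|i IH]; rewrite ?expg0 ?sum_perm11 // !expgS IH sum_permM. Qed.

Lemma porbit_sum_perml s t a b :
  (inl a \in porbit (sum_perm s t) (inl b)) = (a \in porbit s b).
Proof.
apply/porbitP/porbitP=> -[i e]; exists i; move: e; rewrite sum_permX sum_permE.
  by case.
by move->.
Qed.

Lemma porbit_sum_permr s t p q :
  (inr p \in porbit (sum_perm s t) (inr q)) = (p \in porbit t q).
Proof.
apply/porbitP/porbitP=> -[i e]; exists i; move: e; rewrite sum_permX sum_permE.
  by case.
by move->.
Qed.

Lemma perm_tperm_ind (T : finType) (P : {perm T} -> Prop) :
  P 1 -> (forall x y r, P r -> P (tperm x y * r)) -> forall r, P r.
Proof.
move=> P1 PM r; have [ts -> _] := prod_tpermP r.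
by elim: ts => [|u ts IH]; rewrite ?big_nil ?big_cons //; apply: PM.
Qed.

Lemma addn_transfer b d e f g n :
  f + b = e + d -> g + b = n + e + d -> g = n + f.
Proof. lia. Qed.

Lemma addn_bool_inj (x1 x2 x3 x4 v w : nat) (b c d : bool) :
  x1 + w = x2 + v -> x3 + w = x4 + v ->
  x1 + d.*2 = x3 + c -> x2 + b.*2 = x4 + c -> d = b.
Proof. by case: b; case: d => //= ? ? ? ?; lia. Qed.

Lemma addn_transfer_sub x1 x2 y1 y2 b v w d :
  x1 + b = x2 -> x2 + w = y2 + v -> y1 + b = y2 + d -> x1 + (w + d) = y1 + v.
Proof. lia. Qed.

Lemma ncyc_sum_perm s t : ncyc (sum_perm s t) = ncyc s + ncyc t.
Proof.
elim/(@perm_tperm_ind A): s => [|a b s IH].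
  elim/(@perm_tperm_ind M): t => [|p q t IH]; first by rewrite sum_perm11 !ncyc1 card_sum.
  have -> : sum_perm 1 (tperm p q * t) = tperm (inr p) (inr q) * sum_perm 1 t.
    by rewrite -sum_perm_tpermr sum_permM mulg1.
  have := ncyc_tpermM (inr p) (inr q) (sum_perm 1 t).
  rewrite porbit_sum_permr (inj_eq (@inr_inj A M)) IH.
  exact: addn_transfer (ncyc_tpermM p q t).
have -> : sum_perm (tperm a b * s) t = tperm (inl a) (inl b) * sum_perm s t.
  by rewrite -sum_perm_tperml sum_permM mul1g.
have := ncyc_tpermM (inl a) (inl b) (sum_perm s t).
rewrite porbit_sum_perml (inj_eq (@inl_inj A M)) IH.
by rewrite (addnC (ncyc s)) (addnC (ncyc (_ * s))); exact: addn_transfer (ncyc_tpermM a b s).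
Qed.

(* phi induces on the marker set M the same cycle structure as pi; testing     *)
(* this against all permutations of M also pins down the cyclic orders.        *)
Definition tracks (phi : {perm A + M}) (pi : {perm M}) : Prop :=
  exists v w, forall t, ncyc (sum_perm 1 t * phi) + w = ncyc (t * pi) + v.

(** The point in front of which a letter is spliced: the marker itself for an insertion before it,
    the successor of the marker for an insertion after it. *)
Definition target (X : finType) (s : {perm X}) (f : M -> X) (Y : M * bool) : X :=
  if Y.2 then s (f Y.1) else f Y.1.

(** Cycle counts detect orbits: [tperm p q] raises the count exactly when [p] and [q] share a cycle,
    and this transposition can be absorbed into the test permutation [t]. *)
Lemma tracks_porbit phi pi t p q : tracks phi pi ->
  (inr p \in porbit (sum_perm 1 t * phi) (inr q)) = (p \in porbit (t * pi) q).
Proof.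
case=> v [w tr]; have [->|pq] := eqVneq p q; first by rewrite !porbit_id.
have := ncyc_tpermM (inr p) (inr q) (sum_perm 1 t * phi).
have := ncyc_tpermM p q (t * pi).
rewrite (inj_eq (@inr_inj A M)) pq -sum_perm_tpermr (mulgA (sum_perm _ _)) sum_permM mulg1.
have := tr t; have := tr (tperm p q * t).
rewrite -(mulgA (tperm p q)) => e1 e2 e3 e4.
exact/negb_inj/(addn_bool_inj e1 e2 e4 e3).
Qed.

Lemma tracks_target phi pi t Y Z : tracks phi pi ->
  (target phi inr Y \in porbit (sum_perm 1 t * phi) (target phi inr Z)) =
  (target pi id Y \in porbit (t * pi) (target pi id Z)).
Proof.
move=> tr; rewrite /target.
have E p : phi (inr p) = (sum_perm 1 t * phi) (inr (t^-1 p)).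
  by rewrite permM sum_permE permKV.
have E' p : pi p = (t * pi) (t^-1 p) by rewrite permM permKV.
case: Y Z => [p []] [q []] /=; rewrite ?E ?E' ?mem_porbit_perml ?mem_porbit_permr;
  exact: tracks_porbit.
Qed.

(** Apply [ncyc_splice] to [sum_perm 1 t * phi] for every [t]. By [tracks_target] the possible loss
    of two cycles is the same on the side of [pi], so the two counts still differ by a constant. *)
Lemma tracks_step phi pi x x' Y Z :
    tracks phi pi -> phi (inl x) = inl x' -> phi (inl x') = inl x -> x != x' ->
  let phi' := phi * tperm (inl x) (target phi inr Y)
                  * tperm (inl x') (target phi inr Z) in
  let y := target pi id Y in let z := target pi id Z in
  tracks phi' (pi * tperm y z) /\
  ncyc phi' + (y \notin porbit pi z).*2 = ncyc phi.
Proof.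
move=> tr px px' xx' phi' y z.
have targetN W : target phi inr W \notin [:: inl x; inl x'].
  rewrite /target; case: W => p [] //=.
  rewrite !inE; apply/norP; split; apply/eqP => e.
    by have /perm_inj := etrans e (esym px').
  by have /perm_inj := etrans e (esym px).
have splice t : ncyc (sum_perm 1 t * phi') + (y \notin porbit (t * pi) z).*2 =
    ncyc (sum_perm 1 t * phi).
  rewrite /phi' !mulgA /y /z -(tracks_target _ _ _ tr).
  by apply: ncyc_splice; rewrite ?permM ?sum_permE ?perm1 ?px ?px'
    ?(inj_eq (@inl_inj A M)) ?targetN.
split; last by have := splice 1; rewrite sum_perm11 !mul1g.
have [v [w tw]] := tr; exists v, (w + (y != z)) => t.
have := ncyc_Mtperm y z (t * pi).
by rewrite -(mulgA t) => e1; exact: addn_transfer_sub (splice t) (tw t) e1.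
Qed.

End SumPerm.

Section CyclesMore.
Local Open Scope group_scope.
Variable T : finType.
Implicit Types (s t : {perm T}) (w : seq T) (x y z : T).

Lemma wcyc_insert_before w1 x y w2 : uniq (w1 ++ x :: y :: w2) ->
  wcyc (w1 ++ x :: y :: w2) = wcyc (w1 ++ y :: w2) * tperm x y.
Proof. exact: wcyc_insert. Qed.

Lemma wcyc_insert_last y w x : uniq (y :: rcons w x) ->
  wcyc (y :: rcons w x) = wcyc (y :: w) * tperm x y.
Proof.
move=> U; have -> : y :: rcons w x = (y :: w) ++ [:: x] by rewrite cats1.
by rewrite wcyc_insert ?cats0 // cats1.
Qed.

Lemma wcyc_insert_after w1 m x w2 : uniq (w1 ++ m :: x :: w2) ->
  wcyc (w1 ++ m :: x :: w2) =
  wcyc (w1 ++ m :: w2) * tperm x (wcyc (w1 ++ m :: w2) m).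
Proof.
move=> U; rewrite wcyc_head; last first.
  by apply: subseq_uniq U; rewrite -(cat1s m w2) -(cat1s m (_ :: _)) !subseq_cat2l subseq_cons.
rewrite -[m :: x :: w2]cat1s catA wcyc_insert -?catA //=.
congr (_ * tperm x _); case: w2 U => [|y w2 _] //=.
by case: w1.
Qed.

Lemma ncyc_attach s m y : s m = m -> y != m ->
  ncyc (s * tperm m y) + 1 = ncyc s.
Proof.
move=> sm ym; have := ncyc_Mtperm m y s.
by rewrite porbit_sym porbit_fixed // ym eq_sym ym /=; lia.
Qed.

(** Used to erase markers: outside the word [m] is a fixed point, and inserting it joins it to the
    cycle of the next letter, which must exist. *)
Lemma ncyc_attach_word s w1 m w2 :
    s m = m -> uniq (w1 ++ m :: w2) -> w1 ++ w2 != [::] ->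
  ncyc (s * wcyc (w1 ++ m :: w2)) + 1 = ncyc (s * wcyc (w1 ++ w2)).
Proof.
move=> sm U w0; rewrite wcyc_insert // mulgA.
have := U; rewrite -cat1s uniq_catCA /= => /andP[mN U'].
apply: ncyc_attach; first by rewrite permM sm wcyc_notin.
apply: contraNneq mN => <-; rewrite mem_cat orbC -mem_cat.
have : w2 ++ w1 != [::] by rewrite -size_eq0 size_cat addnC -size_cat size_eq0.
by case: (w2 ++ w1) => //= y w _; rewrite mem_head.
Qed.

Lemma ncyc_fcard s : ncyc s = fcard s T.
Proof.
have porbitE x y : (y \in porbit s x) = fconnect s x y.
  apply/porbitP/idP => [[i ->]|/iter_findex <-]; last first.
    by exists (findex s x y); rewrite permX.
  by rewrite permX fconnect_iter.
have symP : connect_sym (frel s) by apply: fconnect_sym perm_inj.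
rewrite /n_comp_mem -(card_in_imset (f := porbit s) (D := [predI froots s & T])).
  rewrite /ncyc; apply: eq_card => P; apply/imsetP/imsetP => -[x xT ->].
    exists (froot s x); first by rewrite !inE roots_root.
    by apply/eqP; rewrite eq_porbit_mem porbitE symP connect_root.
  by exists x.
move=> x y /andP[/eqP rx _] /andP[/eqP ry _] /eqP.
rewrite eq_porbit_mem porbitE => yx.
by rewrite -rx -ry; apply/eqP; rewrite root_connect // symP.
Qed.

End CyclesMore.

(** * Vertices as cycles *)

Section Flip.
Local Open Scope group_scope.
Variable L : finType.

Definition flip_fun (d : L * bool) := (d.1, ~~ d.2).

Lemma flip_fun_inj : injective flip_fun.
Proof. by case=> a b [c d] [-> /negb_inj->]. Qed.

Definition flip : {perm L * bool} := perm flip_fun_inj.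

Lemma flipE a b : flip (a, b) = (a, ~~ b).
Proof. by rewrite permE. Qed.

Lemma ncyc_flip : ncyc flip = #|L|.
Proof.
have mem_flip a b c d : (a, b) \in porbit flip (c, d) -> a = c.
  move=> /(porbit_stable (P := fun u => u.1 == c)) /(_ _)/eqP; apply => //=.
  by case=> a' b'; rewrite flipE.
rewrite -(card_imset _ (f := fun a => porbit flip (a, false))); last first.
  by move=> a c /eqP; rewrite eq_porbit_mem => /mem_flip.
apply: eq_card => P; apply/imsetP/imsetP => -[]; last by move=> a _ ->; exists (a, false).
case=> a [] _ ->; exists a => //.
by rewrite -(eq_porbit_perm _ (a, false)) flipE.
Qed.

(** Gluing identifies the start of a side with the start of the side following its partner, which is
    its image under [flip * wcyc w]. So the gluing relation is the symmetric closure of this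
    permutation. *)
Lemma num_vertices_ncyc (w : seq (L * bool)) :
  uniq w -> (forall d, d \in w) -> num_vertices w = ncyc (flip * wcyc w).
Proof.
move=> Uw allw; set s := flip * wcyc w.
have s_inj : injective s by apply: perm_inj.
have side_inj : injective (@side _ w).
  by move=> i j /(tuple_uniqP (in_tuple w) Uw).
have side_surj d : {i | @side _ w i = d}.
  by have /tnthP/sig_eqW[i ->] : d \in in_tuple w := allw d; exists i.
have side_ordS i : @side _ w (ordS i) = wcyc w (side i).
  have x0 := side i.
  rewrite wcycE // next_nth allw /side !(tnth_nth x0) /=.
  rewrite index_uniq //; case: (w) i => [|x v] [i iw] //=.
  move: iw; rewrite /= ltnS leq_eqVlt => /orP[/eqP ->|iv].
    by rewrite modnn /= nth_default.
  by rewrite modn_small //= (set_nth_default x).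
have gluedE i j : glued i j = (side j == flip (side i)).
  rewrite /glued; case: (side i) => a b; case: (side j) => c d.
  by rewrite flipE /= xpair_eqE eq_sym; case: b d => [] [].
have vgE i j : @vertex_glued _ w i j =
    (s (side i) == side j) || (s (side j) == side i).
  apply/existsP/orP => [[k /existsP[l /andP[]]]|].
    rewrite gluedE => /eqP kl /orP[] /andP[/eqP-> /eqP->].
      by left; rewrite permM side_ordS kl.
    right; rewrite permM side_ordS kl.
    by case: (side k) => a b; rewrite !flipE negbK.
  case=> /eqP e.
    have [l lE] := side_surj (flip (side i)); exists i; apply/existsP; exists l.
    rewrite gluedE lE !eqxx /= -(inj_eq side_inj j (ordS l)) side_ordS lE -e permM.
    by rewrite eqxx.
  have [l lE] := side_surj (flip (side j)); exists l; apply/existsP; exists j.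
  rewrite gluedE lE -(inj_eq side_inj i (ordS l)) side_ordS lE -e permM !eqxx /= orbT andbT.
  by case: (side j) => a b; rewrite !flipE negbK.
have symP : connect_sym (frel s) by apply: fconnect_sym.
rewrite ncyc_fcard; symmetry.
rewrite (adjunction_n_comp (@side _ w) (e' := @vertex_glued _ w)) //=.
- exact: sym_connect_sym (@vertex_glued_sym _ w).
- split=> [d _|i j _].
    by have [i <-] := side_surj d; exists i; apply: connect0.
  apply/idP/idP.
    move=> /connectP[p + ->]; elim: p i => [|k p IH] i //= /andP[].
    rewrite vgE => ik /IH; apply: connect_trans.
    case/orP: ik => ik; last rewrite symP.
      by apply: connect1.
    by apply: connect1.
  move=> /connectP[p + pj]; elim: p i pj => [|d p IH] i /= pj.
    by rewrite (side_inj _ _ pj).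
  have [k kd] := side_surj d; rewrite -kd => /andP[ik /IH]; rewrite kd => /(_ pj).
  by apply: connect_trans; apply: connect1; rewrite vgE ik.
Qed.

End Flip.

(** * Insertion of a letter between markers *)

Arguments wcyc : simpl never.

Section InsertPair.
Local Open Scope group_scope.
Variables (D : finType) (m0 m1 m2 x x' : D) (u1 u2 u3 u4 : seq D).
Let s := wcyc (m0 :: u1 ++ m1 :: u3 ++ u2 ++ m2 :: u4).

Lemma wcyc_after0_before0 :
  let w := m0 :: (x :: u1) ++ m1 :: u3 ++ u2 ++ m2 :: rcons u4 x' in
  uniq w -> wcyc w = s * tperm x (s m0) * tperm x' m0.
Proof.
move=> w; have -> : w = m0 :: rcons (x :: u1 ++ m1 :: u3 ++ u2 ++ m2 :: u4) x'.
  by rewrite /w -!(rcons_cat, rcons_cons).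
move=> U; rewrite wcyc_insert_last //; congr (_ * _).
apply: (@wcyc_insert_after _ [::]).
by move: U; rewrite -rcons_cons rcons_uniq => /andP[].
Qed.

Lemma wcyc_before2_before0 :
  let w := m0 :: u1 ++ m1 :: u3 ++ rcons u2 x ++ m2 :: rcons u4 x' in
  uniq w -> wcyc w = s * tperm x m2 * tperm x' m0.
Proof.
move=> w; pose v := m0 :: u1 ++ m1 :: u3 ++ u2.
have -> : w = m0 :: rcons (behead v ++ x :: m2 :: u4) x'.
  by rewrite /w -cats1 /= -!catA /= -!catA -!(rcons_cat, rcons_cons).
move=> U; rewrite wcyc_insert_last //; congr (_ * _).
have -> : s = wcyc (v ++ m2 :: u4) by rewrite /s /v /= -!catA /= -!catA.
apply: (@wcyc_insert_before _ v).
by move: U; rewrite -rcons_cons rcons_uniq => /andP[].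
Qed.

Lemma wcyc_after0_after1 :
  let w := m0 :: (x :: u1) ++ m1 :: (x' :: u3) ++ u2 ++ m2 :: u4 in
  uniq w -> wcyc w = s * tperm x (s m0) * tperm x' (s m1).
Proof.
move=> w U.
have Ux : uniq (m0 :: x :: u1 ++ m1 :: u3 ++ u2 ++ m2 :: u4).
  apply: subseq_uniq U; rewrite -[X in subseq X]/((m0 :: x :: u1) ++ _).
  by rewrite subseq_cat2l -(cat1s m1) -(cat1s m1 (_ ++ _)) subseq_cat2l subseq_cons.
have E := @wcyc_insert_after _ (m0 :: x :: u1) m1 x' (u3 ++ u2 ++ m2 :: u4) U.
rewrite {}E.
have -> : wcyc ((m0 :: x :: u1) ++ m1 :: u3 ++ u2 ++ m2 :: u4) =
    s * tperm x (s m0) by apply: (@wcyc_insert_after _ [::]).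
(* The target of [x'] is read in the word that already contains [x]; inserting [x] right after [m0]
   does not alter the successor of [m1]. *)
congr (_ * tperm x' _); rewrite permM.
have := Ux; rewrite !cons_uniq => /and3P[m0N xN Us].
rewrite tpermD //.
  have <- : s x = x.
    rewrite /s wcyc_notin //; first rewrite cons_uniq Us andbT.
      by move: m0N; rewrite inE negb_or => /andP[].
    by rewrite inE negb_or xN andbT; move: m0N; rewrite inE eq_sym negb_or => /andP[].
  by rewrite (inj_eq perm_inj); apply: contraNneq xN => ->; rewrite mem_cat mem_head orbT.
by rewrite (inj_eq perm_inj); apply: contraNneq m0N => ->; rewrite inE mem_cat mem_head !orbT.
Qed.

Lemma wcyc_after1_before2 :
  let w := m0 :: u1 ++ m1 :: (x' :: u3) ++ rcons u2 x ++ m2 :: u4 in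
  uniq w -> wcyc w = s * tperm x' (s m1) * tperm x m2.
Proof.
move=> w; have -> : w = (m0 :: u1 ++ m1 :: x' :: u3 ++ u2) ++ x :: m2 :: u4.
  by rewrite /w -cats1 /= -!catA /= -!catA.
move=> U; rewrite wcyc_insert_before //; congr (_ * _).
have E : (m0 :: u1 ++ m1 :: x' :: u3 ++ u2) ++ m2 :: u4 =
  (m0 :: u1) ++ m1 :: x' :: u3 ++ u2 ++ m2 :: u4 by rewrite /= -!catA /= -!catA.
rewrite E; apply: wcyc_insert_after; rewrite -E; apply: subseq_uniq U.
by rewrite subseq_cat2l subseq_cons.
Qed.

End InsertPair.

(** * Ladder words with three markers *)

Section MarkedLadder.
Local Open Scope group_scope.
Variables (L : finType) (K T : {set L}).
Implicit Types (e : seq L) (a : L).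

Local Notation dart := ((L * bool) + 'I_3)%type.
Definition marker (i : nat) : 'I_3 := inord i.
Local Notation M i := (inr (marker i) : dart).

Definition lad1 e : seq (L * bool) := [seq (k, false) | k <- rev [seq k <- e | k \in K]].
Definition lad2 e : seq (L * bool) := [seq (k, false) | k <- e & k \notin K].
Definition lad3 e : seq (L * bool) := [seq (t, true) | t <- rev [seq t <- e | t \in T]].
Definition lad4 e : seq (L * bool) := [seq (t, true) | t <- e & t \notin T].

Definition marked e : seq dart :=
  M 0 :: map inl (lad1 e) ++ M 1 :: map inl (lad3 e) ++
  map inl (lad2 e) ++ M 2 :: map inl (lad4 e).

Lemma lad1_rcons e a :
  lad1 (rcons e a) = if a \in K then (a, false) :: lad1 e else lad1 e.
Proof. by rewrite /lad1 filter_rcons; case: ifP; rewrite // rev_rcons. Qed.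

Lemma lad2_rcons e a :
  lad2 (rcons e a) = if a \in K then lad2 e else rcons (lad2 e) (a, false).
Proof. by rewrite /lad2 filter_rcons; case: (_ \in _); rewrite //= map_rcons. Qed.

Lemma lad3_rcons e a :
  lad3 (rcons e a) = if a \in T then (a, true) :: lad3 e else lad3 e.
Proof. by rewrite /lad3 filter_rcons; case: ifP; rewrite // rev_rcons. Qed.

Lemma lad4_rcons e a :
  lad4 (rcons e a) = if a \in T then lad4 e else rcons (lad4 e) (a, true).
Proof. by rewrite /lad4 filter_rcons; case: (_ \in _); rewrite //= map_rcons. Qed.

Lemma marked_perm e : perm_eq (marked e)
  ([:: M 0; M 1; M 2] ++ map inl [seq (k, false) | k <- e] ++
   map inl [seq (t, true) | t <- e]).
Proof.
apply/seq.permP => p.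
have split_count (S : {set L}) q : count q [seq k <- e | k \in S] +
    count q [seq k <- e | k \notin S] = count q e.
  by rewrite -count_cat; apply/seq.permP; rewrite perm_filterC.
rewrite /marked /lad1 /lad2 /lad3 /lad4 /= !count_cat /= !count_cat /= !count_map.
rewrite !count_rev -(split_count K (preim _ _)) -(split_count T (preim _ _)) /=.
by set c1 := count _ _; set c2 := count _ _; set c3 := count _ _;
   set c4 := count _ _; lia.
Qed.

Lemma mem_marked_inl e a b : (inl (a, b) \in marked e) = (a \in e).
Proof.
have pairb (c : bool) : injective (fun k : L => (k, c)) by move=> x y [].
rewrite (perm_mem (marked_perm e)) !mem_cat !(mem_map (@inl_inj _ _)) /=.
have E (c : bool) : ((a, b) \in [seq (k, c) | k <- e]) = (b == c) && (a \in e).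
  apply/mapP/andP => [[k ke [-> ->]]|[/eqP-> ae]]; first by rewrite eqxx.
  by exists a.
by rewrite !E; clear E; case: b; rewrite ?orbF.
Qed.

Lemma marker_inj : {in [pred i | i < 3] &, injective marker}.
Proof. by move=> i j i3 j3 /(congr1 val); rewrite /= !inordK. Qed.

Lemma uniq_marked e : uniq e -> uniq (marked e).
Proof.
move=> Ue; rewrite (perm_uniq (marked_perm e)) !cat_uniq.
have pairb (c : bool) : injective (fun k : L => (k, c)) by move=> x y [].
rewrite !(map_inj_uniq (@inl_inj _ _)) !(map_inj_uniq (pairb _)) Ue !andbT /=.
rewrite !inE !negb_or !andbT !(inj_eq (@inr_inj _ _)) !(inj_in_eq marker_inj) //=.
apply/andP; split; last first.
  by apply/hasPn => _ /mapP[_ /mapP[x _ ->] ->]; apply/mapP => -[_ /mapP[y _ ->]].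
by apply/hasPn => x; rewrite mem_cat => /orP[] /mapP[y _ ->].
Qed.

(* The cycles without markers are the vertices already closed off, besides a   *)
(* 2-cycle (a a^-) for each letter that is not used yet.                       *)
Definition phi e : {perm dart} := sum_perm (flip L) 1 * wcyc (marked e).

(* Where the next letters a and a^- go, just after the marker if the boolean   *)
(* is true and just before it otherwise. If k is false and t is true, the      *)
(* first corner is that of a^-: when the corners coincide, the word must read  *)
(* M1 a^- a M2, so a^- has to be inserted first.                               *)
Definition corners (k t : bool) : ('I_3 * bool) * ('I_3 * bool) :=
  match k, t with
  | true, false => ((marker 0, true), (marker 0, false))
  | false, false => ((marker 2, false), (marker 0, false))
  | true, true => ((marker 0, true), (marker 1, true))
  | false, true => ((marker 1, true), (marker 2, false))
  end.

Lemma phi_inr e p : phi e (inr p) = wcyc (marked e) (inr p).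
Proof. by rewrite permM sum_permE perm1. Qed.

Lemma phi_rcons e a : uniq (rcons e a) -> exists c,
  let Y := corners (a \in K) (a \in T) in
  phi (rcons e a) = phi e * tperm (inl (a, c)) (target (phi e) inr Y.1)
                          * tperm (inl (a, ~~ c)) (target (phi e) inr Y.2).
Proof.
move=> /uniq_marked; rewrite /corners /target.
have mul4 (p q r s : {perm dart}) : p * (q * r * s) = p * q * r * s by rewrite !mulgA.
have -> : phi (rcons e a) = sum_perm (flip L) 1 * wcyc (marked (rcons e a)) by [].
have -> : marked (rcons e a) = M 0 :: map inl (lad1 (rcons e a)) ++
   M 1 :: map inl (lad3 (rcons e a)) ++ map inl (lad2 (rcons e a)) ++
   M 2 :: map inl (lad4 (rcons e a)) by [].
rewrite lad1_rcons lad2_rcons lad3_rcons lad4_rcons.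
case: (a \in K); case: (a \in T); rewrite ?map_rcons ?map_cons => U.
- by exists false; rewrite /= !phi_inr (wcyc_after0_after1 U); apply: mul4.
- by exists false; rewrite /= ?phi_inr (wcyc_after0_before0 U); apply: mul4.
- by exists true; rewrite /= ?phi_inr (wcyc_after1_before2 U); apply: mul4.
by exists false; rewrite /= ?phi_inr (wcyc_before2_before0 U); apply: mul4.
Qed.

Definition pi0 : {perm 'I_3} := tperm (marker 1) (marker 2) * tperm (marker 0) (marker 1).

Definition step (st : {perm 'I_3} * nat) (b : bool * bool) :=
  let: (Y, Z) := corners b.1 b.2 in
  let y := target st.1 id Y in let z := target st.1 id Z in
  (st.1 * tperm y z, st.2 + (y \notin porbit st.1 z)).

Definition run (bs : seq (bool * bool)) := foldl step (pi0, 0) bs.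

Definition choices e := [seq (a \in K, a \in T) | a <- e].

Lemma phi_nil : phi [::] = sum_perm (flip L) pi0.
Proof.
have E : wcyc (marked [::]) =
  1 * tperm (M 2) (M 2) * tperm (M 1) (M 2) * tperm (M 0) (M 1) by [].
by rewrite /phi E tperm1 !mul1g -!sum_perm_tpermr !sum_permM !mul1g mulg1.
Qed.

Lemma ncyc_pi0 : ncyc pi0 = 1%N.
Proof.
have := ncyc_attach (s := tperm (marker 1) (marker 2)) (m := marker 0) (y := marker 1).
rewrite tpermD ?(inj_in_eq marker_inj) //= => /(_ erefl isT).
have := ncyc_attach (s := 1) (m := marker 1) (y := marker 2).
rewrite perm1 ?(inj_in_eq marker_inj) //= mul1g ncyc1 card_ord => /(_ erefl isT).
by rewrite !addn1 => -[->] -[].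
Qed.

(** At the start there are [#|L|] 2-cycles and one cycle through the markers. Each letter whose
    corners lie on different cycles costs two cycles and is counted once by [run]. *)
Lemma phi_run e : uniq e ->
  tracks (phi e) (run (choices e)).1 /\ ncyc (phi e) + (run (choices e)).2.*2 = #|L|.+1.
Proof.
elim/last_ind: e => [|e a IH] U.
  rewrite phi_nil ncyc_sum_perm ncyc_flip ncyc_pi0 addn0 addn1; split=> //.
  exists (ncyc (flip L)), 0 => t.
  by rewrite sum_permM mul1g ncyc_sum_perm addn0 addnC.
have [c E] := phi_rcons U; move: U; rewrite rcons_uniq => /andP[aN U].
have [tr cnt] := IH U.
have phi_a d : phi e (inl (a, d)) = inl (a, ~~ d).
  by rewrite permM sum_permE flipE wcyc_notin ?uniq_marked // mem_marked_inl.
have neq : (a, c) != (a, ~~ c) by rewrite xpair_eqE eqxx; case: (c).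
have := tracks_step (corners (a \in K) (a \in T)).1
  (corners (a \in K) (a \in T)).2 tr (phi_a c) _ neq.
rewrite phi_a negbK => /(_ erefl) /=; rewrite -E => -[tr' cnt'].
rewrite /choices map_rcons /run foldl_rcons -/(run _) -/(choices e) /step /=.
case: (corners _ _) tr' cnt' => Y Z /= tr' cnt'.
by split=> //; rewrite doubleD addnA addnAC -cnt -cnt'.
Qed.

Definition ladder e := lad1 e ++ lad3 e ++ lad2 e ++ lad4 e.

Lemma uniq_ladder e : uniq e -> uniq (ladder e).
Proof.
move=> /uniq_marked U; rewrite -(map_inj_uniq (@inl_inj _ 'I_3)).
apply: subseq_uniq U; rewrite /ladder /marked !map_cat.
rewrite -[X in subseq _ X]cat1s -(cat1s (M 1)) -(cat1s (M 2)).
apply: subseq_trans (suffix_subseq _ _); apply: cat_subseq => //.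
apply: subseq_trans (suffix_subseq _ _); do 2 apply: cat_subseq => //.
exact: suffix_subseq.
Qed.

Lemma wcyc_map_inl (w : seq (L * bool)) : uniq w ->
  wcyc (map inl w : seq dart) = sum_perm (wcyc w) 1.
Proof.
move=> U; apply/permP => -[d|m].
  rewrite sum_permE !wcycE ?(map_inj_uniq (@inl_inj _ _)) //.
  by rewrite (next_map (@inl_inj _ _)).
rewrite sum_permE perm1 wcyc_notin ?(map_inj_uniq (@inl_inj _ _)) //.
by apply/mapP => -[].
Qed.

(** The three markers are three fixed points beside the unmarked word, and inserting each of them
    uses up one cycle. *)
Lemma ncyc_ladder e : uniq e -> e != [::] ->
  ncyc (flip L * wcyc (ladder e)) = ncyc (phi e).
Proof.
move=> U e0; set f := sum_perm (flip L) (1 : {perm 'I_3}).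
have f_inr m : f (inr m) = inr m by rewrite sum_permE perm1.
have nil_ladder : map inl (ladder e) != [::] :> seq dart.
  case: e e0 U => // a e _ U; apply/eqP => E.
  have : inl (a, true) \in marked (a :: e) by rewrite mem_marked_inl mem_head.
  have : inl (a, true) \notin (map inl (ladder (a :: e)) : seq dart) by rewrite E.
  rewrite /marked /ladder !map_cat !(inE, mem_cat) !negb_or.
  by case/and4P => /negPf-> /negPf-> /negPf-> /negPf->.
have := uniq_marked U; rewrite /phi -/f /marked.
set v1 := map inl (lad1 e); set v2 := map inl (lad2 e).
set v3 := map inl (lad3 e); set v4 := map inl (lad4 e) => U0.
have E : map inl (ladder e) = v1 ++ v3 ++ v2 ++ v4 by rewrite /ladder !map_cat.
have := U0; rewrite cons_uniq => /andP[_ U1].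
have U2 : uniq ((v1 ++ v3 ++ v2) ++ M 2 :: v4).
  apply: subseq_uniq U1; rewrite -!catA subseq_cat2l; exact: subseq_cons.
have nil2 : (v1 ++ v3 ++ v2) ++ v4 != [::] by rewrite -!catA -E.
have nil1 : v1 ++ v3 ++ v2 ++ M 2 :: v4 != [::].
  by rewrite -size_eq0 !size_cat /= !addnS.
have e0' := @ncyc_attach_word _ f [::] (M 0) _ (f_inr _) U0.
have e1' := ncyc_attach_word (f_inr _) U1 nil1.
have e2' := ncyc_attach_word (f_inr _) U2 nil2.
rewrite -!catA -E wcyc_map_inl ?uniq_ladder // sum_permM ncyc_sum_perm in e2'.
rewrite mulg1 ncyc1 card_ord in e2'.
have nil0 : v1 ++ M 1 :: v3 ++ v2 ++ M 2 :: v4 != [::].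
  by rewrite -size_eq0 !size_cat /= !addnS.
apply: (@addIn 3); rewrite -e2' -e1' -(e0' nil0) !addn1 !addnS addn0.
by [].
Qed.

End MarkedLadder.

(** * The six states *)

Section Ladders.
Local Open Scope group_scope.

Lemma has_genus_ladder n (K T : {set 'I_n}) g : 0 < n ->
  has_genus (ladder_word K T) g = (g == (run (choices K T (enum 'I_n))).2).
Proof.
move=> n0; set r := (run _).2.
have Ue : uniq (enum 'I_n) := enum_uniq 'I_n.
have e0 : enum 'I_n != [::] by rewrite -size_eq0 size_enum_ord -lt0n.
have wE : ladder_word K T = ladder K T (enum 'I_n).
  rewrite /ladder_word /ladder /R1 /R2 /R3 /R4 /lad1 /lad2 /lad3 /lad4.
  have E (S : {set 'I_n}) : enum S = [seq k <- enum 'I_n | k \in S].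
    by rewrite [in RHS]enumT.
  rewrite !E; do 3 congr (_ ++ _); congr (map _ _); apply: eq_filter => k;
    by rewrite inE.
have all_w (d : 'I_n * bool) : d \in ladder_word K T by exact: mem_ladder_word.
have V : num_vertices (ladder_word K T) + r.*2 = n.+1.
  rewrite num_vertices_ncyc //; last by rewrite wE uniq_ladder.
  by rewrite wE ncyc_ladder // (phi_run K T Ue).2 card_ord.
rewrite /has_genus /euler_char size_ladder_word doubleK.
by apply/eqP/eqP; move: V; rewrite -!muln2; lia.
Qed.

(** The whole symmetric group on the markers; states 0 and 5 are the 3-cycles, of opposite
    orientation. *)
Definition state_perm (s : nat) : {perm 'I_3} :=
  match s with
  | 0 => pi0
  | 1 => tperm (marker 0) (marker 1)
  | 2 => tperm (marker 0) (marker 2)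
  | 3 => tperm (marker 1) (marker 2)
  | 4 => 1
  | _ => tperm (marker 0) (marker 1) * tperm (marker 1) (marker 2)
  end.

(** The boolean tells whether the corners lie on different cycles, that is, whether the genus
    grows. *)
Definition transition (s : nat) (b : bool * bool) : nat * bool :=
  match s, b with
  | 0, (true, false) => (3, false)
  | 0, (false, false) => (1, false)
  | 0, (true, true) => (2, false)
  | 0, (false, true) => (0, false)
  | 1, (true, _) => (4, false)
  | 1, (false, _) => (0, true)
  | 2, (_, false) => (4, false)
  | 2, (_, true) => (0, true)
  | 3, (true, false) => (3, false)
  | 3, (false, true) => (3, false)
  | 3, _ => (5, true)
  | 4, (true, false) => (4, false)
  | 4, (false, false) => (2, true)
  | 4, (true, true) => (1, true)
  | 4, (false, true) => (3, true)
  | _, _ => (3, false)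
  end%N.

Definition table_step (x : nat * nat) b :=
  let: (s, d) := transition x.1 b in (s, x.2 + d).

Definition table_run (bs : seq (bool * bool)) := foldl table_step (0, 0)%N bs.

Lemma porbit3 (s : {perm 'I_3}) y z :
  (y \in porbit s z) = (y \in [:: z; s z; s (s z)]).
Proof.
apply/idP/idP; last first.
  by rewrite !inE => /or3P[] /eqP->; rewrite ?mem_porbit_perml porbit_id.
rewrite porbit_traject => /trajectP[i ip ->].
have i3 : i < 3 by apply: leq_trans ip _; apply: leq_trans (max_card _) _; rewrite card_ord.
by case: i {ip} i3 => [|[|[|]]] //= _; rewrite !inE eqxx ?orbT.
Qed.

Lemma markerK (x : 'I_3) : x = marker x.
Proof. by rewrite /marker inord_val. Qed.

Lemma tperm_marker a b c : a < 3 -> b < 3 -> c < 3 ->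
  tperm (marker a) (marker b) (marker c) =
  marker (if c == a then b else if c == b then a else c).
Proof.
move=> a3 b3 c3; case: eqP => [->|ca]; first by rewrite tpermL.
case: eqP => [->|cb]; first by rewrite tpermR.
by rewrite tpermD // (inj_in_eq marker_inj) //; apply/eqP => e; [case: ca|case: cb].
Qed.

Lemma step_transition s g b : s < 6 ->
  step (state_perm s, g) b =
  (state_perm (transition s b).1, g + (transition s b).2).
Proof.
have mkE a c : a < 3 -> c < 3 -> (marker a == marker c) = (a == c).
  by move=> a3 c3; rewrite (inj_in_eq marker_inj).
have eqp (p q : {perm 'I_3}) : p (marker 0) = q (marker 0) -> p (marker 1) = q (marker 1) ->
    p (marker 2) = q (marker 2) -> p = q.
  by move=> e0 e1 e2; apply/permP => x; rewrite (markerK x); case: x => [[|[|[|]]]].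
move=> s6; rewrite /step; case: b => k t.
case: s s6 => [|[|[|[|[|[|s]]]]]] // _.
all: case: k; case: t; rewrite /= /target /= !porbit3 !inE /pi0.
all: congr (_, _ + _); [apply: eqp | ]; rewrite ?permM ?perm1.
all: do ?[rewrite tperm_marker //=]; rewrite ?mkE //=.
Qed.

End Ladders.

(** * Counting words by state and genus *)

Fixpoint words (n : nat) : seq (seq (bool * bool)) :=
  if n is n'.+1 then
    [seq rcons w (true, true) | w <- words n'] ++
    [seq rcons w (true, false) | w <- words n'] ++
    [seq rcons w (false, true) | w <- words n'] ++
    [seq rcons w (false, false) | w <- words n']
  else [:: [::]].

Lemma mem_words n w : (w \in words n) = (size w == n).
Proof.
elim: n w => [|n IH] w; first by rewrite inE size_eq0.
case/lastP: w => [|w b].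
  rewrite !mem_cat; apply/negP => /or4P[] /mapP[u _ /(congr1 size)];
    by rewrite size_rcons.
have inj c : injective (fun w : seq (bool * bool) => rcons w c).
  by move=> u v /rcons_inj[].
have E c : (rcons w b \in [seq rcons w c | w <- words n]) = (b == c) && (size w == n).
  apply/mapP/andP => [[u + /rcons_inj[-> ->]]|[/eqP-> wn]].
    by rewrite IH eqxx => ->.
  by exists w; rewrite ?IH.
rewrite !mem_cat !E size_rcons eqSS; case: (size w == n); rewrite ?andbF ?andbT //.
by case: b {E} => [[] []].
Qed.

Lemma uniq_words n : uniq (words n).
Proof.
elim: n => //= n IH.
have inj (c : bool * bool) : injective (fun w => rcons w c).
  by move=> u v /rcons_inj[].
rewrite !cat_uniq !(map_inj_uniq (inj _)) IH !andbT /=.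
apply/and3P; split; apply/hasPn => w; rewrite ?mem_cat.
- by case/or3P => /mapP[u _ ->]; apply/mapP => -[v _ /rcons_inj[]].
- by case/orP => /mapP[u _ ->]; apply/mapP => -[v _ /rcons_inj[]].
by case/mapP=> [u _ ->]; apply/mapP => -[v _ /rcons_inj[]].
Qed.

Lemma run_table bs : (table_run bs).1 < 6 /\
  run bs = (state_perm (table_run bs).1, (table_run bs).2).
Proof.
elim/last_ind: bs => [|bs b [s6 E]] //.
rewrite /run /table_run !foldl_rcons -/(run bs) -/(table_run bs) E step_transition //.
rewrite /table_step; case: (table_run bs) s6 => s g /= s6.
have : (transition s b).1 < 6.
  by case: b => [[] []]; case: s s6 => [|[|[|[|[|[|s]]]]]].
by case: (transition s b).
Qed.

Lemma genus_count_words n i : 0 < n ->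
  genus_count n i = count (fun w => (table_run w).2 == i) (words n).
Proof.
move=> n0; pose F (KT : {set 'I_n} * {set 'I_n}) := choices KT.1 KT.2 (enum 'I_n).
have F_inj : injective F.
  move=> [K T] [K' T'] /eq_in_map E; congr (_, _); apply/setP => k;
    by have [] := E k (mem_enum _ k).
rewrite /genus_count cardE -(size_map F) -size_filter.
apply/perm_size/uniq_perm.
- by rewrite map_inj_uniq ?enum_uniq.
- by rewrite filter_uniq // uniq_words.
move=> w; rewrite mem_filter mem_words; apply/mapP/andP.
  case=> KT; rewrite mem_enum inE has_genus_ladder // => gi ->.
  rewrite /F size_map size_enum_ord eqxx; split=> //.
  by move: gi; rewrite (run_table _).2 /= eq_sym.
case=> gi /eqP wn; pose b0 := (false, false).
pose K := [set k : 'I_n | (nth b0 w k).1]; pose T := [set k : 'I_n | (nth b0 w k).2].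
have E : choices K T (enum 'I_n) = w.
  apply: (@eq_from_nth _ b0) => [|k]; rewrite size_map size_enum_ord ?wn // => kn.
  rewrite (nth_map (Ordinal kn)) ?size_enum_ord //= !inE nth_enum_ord //.
  by case: (nth _ _ _).
exists (K, T); last by rewrite /F E.
by rewrite mem_enum inE has_genus_ladder //= E (run_table _).2 /= eq_sym.
Qed.

Definition state_count n s i := count (fun w => table_run w == (s, i)) (words n).

Lemma genus_count_states n i : 0 < n ->
  genus_count n i = state_count n 0 i + state_count n 1 i + state_count n 2 i +
    state_count n 3 i + state_count n 4 i + state_count n 5 i.
Proof.
move=> n0; rewrite genus_count_words // /state_count.
elim: (words n) => //= w l ->.
have [+ _] := run_table w; case: (table_run w) => s g /=.
rewrite !xpair_eqE; case: (g == i); last by rewrite !andbF.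
by case: s => [|[|[|[|[|[|s]]]]]] //= _; lia.
Qed.

Definition shift (f : nat -> nat) i := if i is i'.+1 then f i' else 0.

(** States 1 and 2 have equally many transitions to each state with each genus change, so only the
    sum of their counts has to be followed. *)
Lemma state_countS n i :
  [/\ state_count n.+1 0 i = state_count n 0 i +
        (shift (state_count n 1) i + shift (state_count n 2) i).*2,
      state_count n.+1 1 i + state_count n.+1 2 i =
        (state_count n 0 i + shift (state_count n 4) i).*2,
      state_count n.+1 3 i = state_count n 0 i + (state_count n 3 i).*2 +
        shift (state_count n 4) i + 4 * state_count n 5 i,
      state_count n.+1 4 i = state_count n 4 i +
        (state_count n 1 i + state_count n 2 i).*2 &
      state_count n.+1 5 i = (shift (state_count n 3) i).*2].
Proof.
rewrite /state_count /= !count_cat !count_map.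
have E b w : table_run (rcons w b) = table_step (table_run w) b by rewrite /table_run foldl_rcons.
have Es c s : count (preim (fun w => rcons w c) (fun w => table_run w == (s, i))) (words n)
  = count (fun x => table_step x c == (s, i)) [seq table_run w | w <- words n].
  by rewrite count_map; apply: eq_count => w /=; rewrite E.
rewrite {E} !Es {Es}.
have Em s j : count (fun w => table_run w == (s, j)) (words n) =
  count (fun x => x == (s, j)) [seq table_run w | w <- words n] by rewrite count_map.
have : all (fun x => x.1 < 6) [seq table_run w | w <- words n].
  by apply/allP => _ /mapP[w _ ->]; have [] := run_table w.
case: i => [|i]; rewrite /shift ?Em {Em}; elim: [seq _ | _ <- _].
- by [].
- move=> [s g] l IH /= /andP[s6 /IH{IH}[]]; rewrite /table_step /=.
  case: s s6 => [|[|[|[|[|[|s]]]]]] //= _; rewrite ?addn0 ?addn1 !xpair_eqE /=;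
  case: (g == 0) => /= *; split; lia.
- by [].
move=> [s g] l IH /= /andP[s6 /IH{IH}[]]; rewrite /table_step /=.
case: s s6 => [|[|[|[|[|[|s]]]]]] //= _; rewrite ?addn0 ?addn1 !xpair_eqE /= ?eqSS;
case: (g == i); case: (g == i.+1) => /= *; split; lia.
Qed.

(** * Closed forms *)

(** Coefficients of the Fibonacci polynomials, with F_(n+2) = F_(n+1) + z F_n. *)
Definition fibc (n i : nat) := 'C(n - i, i).

Lemma fibc0 n : fibc n 0 = 1.
Proof. by rewrite /fibc subn0 bin0. Qed.

Lemma fibc_small n i : n < i.*2 -> fibc n i = 0.
Proof. by move=> h; rewrite /fibc bin_small //; lia. Qed.

Lemma fibcSS n i : fibc n.+2 i.+1 = fibc n.+1 i.+1 + fibc n i.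
Proof.
rewrite /fibc !subSS; have [ni|ni] := leqP i n; first by rewrite subSn // binS.
have -> : n.+1 - i = 0 by lia.
have -> : n - i = 0 by lia.
by case: i ni.
Qed.

Lemma state_count0 s i : state_count 0 s i = (s == 0) && (i == 0).
Proof. by rewrite /state_count /= addn0 xpair_eqE eq_sym (eq_sym 0). Qed.

Definition closed_forms n := forall i,
  [/\ 2 * state_count n 0 i = 8 ^ i * fibc n i + (i == 0),
      2 * state_count n 4 i = 8 ^ i.+1 * fibc n i.+1 &
      state_count n 3 i + 8 ^ i * fibc n i = 2 ^ (n + i) * fibc n i].

Lemma state_count12 n i : closed_forms n ->
  state_count n.+1 1 i + state_count n.+1 2 i = 2 * 8 ^ i * fibc n i.
Proof.
move=> cf; have [_ -> _ _ _] := state_countS n i.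
have [c _ _] := cf i; case: i c => [|i] c; rewrite /shift.
  by move: c; rewrite fibc0 expn0; lia.
by have [_ e _] := cf i; move: c e; rewrite expnS; lia.
Qed.

(** Two-step induction: the counts of state 5 and of states 1 and 2 together are expressed by the
    row before, which makes the recurrences second order. *)
Lemma closed_formsP n : closed_forms n.
Proof.
suff : closed_forms n /\ closed_forms n.+1 by case.
elim: n => [|n [IH IH1]].
  split=> i.
    rewrite !state_count0; case: i => [|i]; last by rewrite !fibc_small //; split; lia.
    by rewrite fibc0 fibc_small.
  have [-> _ -> -> _] := state_countS 0 i.
  case: i => [|i]; rewrite /shift ?state_count0 /= ?fibc0 ?fibc_small //; last by split; lia.
split=> // i.
have [c e s] := IH1 i; have [-> _ -> -> _] := state_countS n.+1 i.
have [_ _ _ _ d] := state_countS n i.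
have t := state_count12 i IH.
rewrite {}d {}t.
case: i c e s => [|i]; rewrite /shift => c e s.
  move: c e s; rewrite (fibcSS n 0) !fibc0 !expn0 !addn0 (expnS _ n.+1); split; lia.
have [c' e' s'] := IH1 i; have [_ _ s''] := IH i.
have t := state_count12 i IH.
have p2 : 2 ^ (n.+2 + i.+1) = 8 * 2 ^ (n + i).
  by rewrite -[8]/(2 ^ 3) -expnD; congr (_ ^ _); lia.
have p2' : 2 ^ (n.+1 + i.+1) = 4 * 2 ^ (n + i).
  by rewrite -[4]/(2 ^ 2) -expnD; congr (_ ^ _); lia.
move: c e s e' s'' t; rewrite p2 p2' !fibcSS !(expnS 8).
set E := 8 ^ i; set P := 2 ^ _; set f := fibc n i.
split; nia.
Qed.

Definition ucoef n i := 2 * fibc n.+1 i + shift (fibc n) i.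

(** The last factor of the term in [8 ^ i] is [8 * ucoef n i.+1], so the whole row is governed by
    one family of coefficients. *)
Lemma genus_countE n i :
  4 * genus_count n.+1 i + 8 ^ i * ucoef n i =
  2 ^ (n.+1 + i).+1 * ucoef n i + 8 ^ i * (16 * fibc n.+1 i.+1 + 8 * fibc n i)
  + 2 * (i == 0).
Proof.
rewrite genus_count_states // /ucoef.
have [c e s] := closed_formsP n.+1 i.
have t := state_count12 i (closed_formsP n).
have [_ _ _ _ d] := state_countS n i.
rewrite {}d; case: i c e s t => [|i] c e s t; rewrite /shift.
  by move: c e s t; rewrite !expnS; lia.
have [_ _ s'] := closed_formsP n i.
have p2 : 2 ^ (n.+1 + i.+1) = 4 * 2 ^ (n + i).
  by rewrite -[4]/(2 ^ 2) -expnD; congr (_ ^ _); lia.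
move: c e s t s'; rewrite (expnS 2) !(expnS 8) p2.
set E := 8 ^ i; set P := 2 ^ _.
by nia.
Qed.

(** * Monotonicity *)

Section Ratios.
Variables (n i m : nat).
Hypothesis nE : n.+1 = i.*2 + m.

Lemma fibc_gt0 : 0 < fibc n.+1 i.
Proof. by rewrite /fibc bin_gt0; lia. Qed.

Lemma shift_fibcE : m.+1 * shift (fibc n) i = i * fibc n.+1 i.
Proof.
case: i nE => [|k] e; rewrite /shift ?mul0n ?muln0 //.
have := mul_bin_left (n - k) k; rewrite /fibc subSS => ->.
by congr (_ * _); lia.
Qed.

Lemma fibc_predE : (i + m) * fibc n i = m * fibc n.+1 i.
Proof.
have := mul_bin_down (n.+1 - i) i; rewrite /fibc.
have -> : (n.+1 - i).-1 = n - i by lia.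
have -> : n.+1 - i = i + m by lia.
by rewrite addKn.
Qed.

Lemma fibc_succE : 0 < m -> i.+1 * fibc n.+1 i.+1 = m.-1 * fibc n i.
Proof.
move=> m0; rewrite /fibc subSS mul_bin_left; congr (_ * _); lia.
Qed.

End Ratios.

(** Clearing the denominators of the three binomial ratios makes both quantities polynomial
    multiples of [fibc n.+1 i], so that comparing them is a polynomial inequality. *)
Lemma ucoef_scaled n i m : n.+1 = i.*2 + m.+1 ->
  (m.+2 * (i + m.+1) * i.+1) * ucoef n i =
    (2 * m.+2 + i) * (i + m.+1) * i.+1 * fibc n.+1 i /\
  (m.+2 * (i + m.+1) * i.+1) * (2 * ucoef n i.+1) =
    2 * m.+1 * m.+2 * (2 * m + i.+1) * fibc n.+1 i.
Proof.
move=> nE; have := shift_fibcE nE; have := fibc_predE nE.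
have := fibc_succE nE (ltn0Sn m).
rewrite /ucoef [shift _ i.+1]/= [_.-1]/=.
move: (fibc n.+1 i) (fibc n i) (fibc n.+1 i.+1) (shift _ _) => X z x1 Y e1 e2 e3.
have e3' := congr1 (muln ((i + m.+1) * i.+1)) e3.
have e2' := congr1 (muln (2 * m.+2 * (i.+1 + 2 * m))) e2.
have e1' := congr1 (muln (4 * m.+2 * (i + m.+1))) e1.
by split; lia.
Qed.

Lemma ucoef_incr n i m : n.+1 = i.*2 + m -> i < m -> 1 < m ->
  ucoef n i < 2 * ucoef n i.+1.
Proof.
case: m => // m nE; rewrite !ltnS => im m0; have X0 := fibc_gt0 nE.
have [E1 E2] := ucoef_scaled nE.
have : 0 < m.+2 * (i + m.+1) * i.+1 by rewrite !muln_gt0 addnS.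
move=> /ltn_pmul2l <-; rewrite E1 E2 ltn_pmul2r //.
have [k mE] : exists k, m = i + k by exists (m - i); lia.
have D0 : 0 < 3 * i + 8 * k by lia.
(* Expanded in [i] and [k = m - i], the difference has only nonnegative coefficients. *)
have -> : 2 * m.+1 * m.+2 * (2 * m + i.+1) = (2 * m.+2 + i) * (i + m.+1) * i.+1 +
    (3 * i + 8 * k + (3 * i * i + 21 * i * k + 12 * i * k * k + 9 * i * i * k
      + 12 * k * k + 4 * k * k * k)) by rewrite mE; lia.
by rewrite -[X in X < _]addn0 ltn_add2l ltn_addr.
Qed.

(** The surplus [6 * fibc n.+1 i] is kept to absorb, after multiplication by a large power of 2, the
    terms that may still increase beyond the peak. *)
Lemma ucoef_decr n i m : n.+1 = i.*2 + m -> 0 < m -> m <= i ->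
  n.+3 * (2 * ucoef n i.+1) + 6 * fibc n.+1 i <= n.+3 * ucoef n i.
Proof.
case: m => // m nE _ im; have X0 := fibc_gt0 nE.
have [E1 E2] := ucoef_scaled nE.
set d := m.+2 * (i + m.+1) * i.+1 in E1 E2.
have d0 : 0 < d by rewrite !muln_gt0 addnS.
rewrite -(leq_pmul2l d0) mulnDr !(mulnCA d n.+3) E1 E2 !mulnA -mulnDl leq_pmul2r //.
have [k iE] : exists k, i = m.+1 + k by exists (i - m.+1); lia.
rewrite /d; have -> : n.+3 = 2 * i + m + 3 by lia.
have -> : (2 * i + m + 3) * (2 * m.+2 + i) * (i + m.+1) * i.+1 =
  (2 * i + m + 3) * 2 * m.+1 * m.+2 * (2 * m + i.+1) +
  m.+2 * (i + m.+1) * i.+1 * 6 + (4 * k * k + 8 * k * k * k + 2 * k * k * k * k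
   + 10 * k + 12 * m * k + 33 * m.+1 * k * k + 15 * m.+1 * k * k * k +
   6 * m.+1 * m.+1 + 39 * m.+1 * m.+1 * k + 36 * m.+1 * m.+1 * k * k
   + 6 * m.+1 * m.+1 * m.+1 + 27 * m.+1 * m.+1 * m.+1 * k) by rewrite iE; lia.
by apply: leq_trans (leq_addr _ _); rewrite leq_eqVlt; apply/orP; left; apply/eqP; lia.
Qed.

Lemma ratio_leq a b p q x y :
  a * y = b * x -> 0 < b -> p * a <= q * b -> p * x <= q * y.
Proof.
move=> e b0 pq; rewrite -(leq_pmul2l b0) mulnCA -e mulnA (mulnCA b) mulnA.
by rewrite leq_mul2r pq orbT.
Qed.

Lemma genus_count_incr n i : 43 <= n -> 3 * i <= n ->
  genus_count n.+1 i < genus_count n.+1 i.+1.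
Proof.
move=> n43 in3; pose m := n.+1 - i.*2.
have nE : n.+1 = i.*2 + m by rewrite /m; lia.
have im : i < m by rewrite /m; lia.
have m15 : 15 <= m by rewrite /m; lia.
have u := ucoef_incr nE im (leq_trans (isT : 1 < 15) m15).
have nE' : n.+1 = (i.+1).*2 + (m - 2) by lia.
have r1 := fibc_succE nE ltac:(lia); have r2 := fibc_predE nE'.
have r3 := fibc_succE nE' ltac:(lia).
have g0 := genus_countE n i; have g1 := genus_countE n i.+1.
have E : 2 ^ (n.+1 + i).+1 = 8 ^ i * 2 ^ m.+1.
  by rewrite -[8]/(2 ^ 3) -expnM -expnD; congr (_ ^ _); lia.
have E' : 2 ^ (n.+1 + i.+1).+1 = 2 * (8 ^ i * 2 ^ m.+1) by rewrite -E -expnS; congr (_ ^ _); lia.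
move: u; rewrite {}E in g0; rewrite {}E' expnS in g1; move: g0 g1.
have -> : ucoef n i.+1 = 2 * fibc n.+1 i.+1 + fibc n i by [].
move: (ucoef n i) (fibc n.+1 i.+1) (fibc n i) (fibc n.+1 i.+2) (fibc n i.+1) r1 r2 r3.
move=> u x1 z x2 z1 r1 r2 r3.
have P2 : 4 <= 2 ^ m.+1 by rewrite -[4]/(2 ^ 2) leq_exp2l //; lia.
have P8 : 0 < 8 ^ i by rewrite expn_gt0.
move: (2 ^ m.+1) (8 ^ i) P2 P8 => B G B4 G0 g0 g1 uu.
(* The constants close the chain 32 x1 + 16 z <= 64 x1 <= 160 z1 <= 128 x2 + 64 z1. Thus the
   positive [8 ^ i] term at [i.+1] covers both its counterpart at [i] and the amount subtracted at
   [i.+1]; the bounds hold since [i < m] and [15 <= m]. *)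
have h0 : 1 * z <= 2 * x1 by apply: (ratio_leq r1); lia.
have h1 : 2 * x1 <= 5 * z1 by apply: (ratio_leq r2); lia.
have h2 : 3 * z1 <= 4 * x2 by apply: (ratio_leq r3); lia.
have h3 : G * (16 * (2 * x1 + z)) <= G * (8 * (16 * x2 + 8 * z1)).
  by rewrite leq_mul2l; apply/orP; right; lia.
have h4 : G * B * u.+1 <= G * B * (2 * (2 * x1 + z)) by rewrite leq_mul.
(* The strict gain of [ucoef_incr], worth [G * B], exceeds the correction 2 that occurs at
   [i = 0]. *)
have h5 : G * 4 <= G * B by rewrite leq_mul.
rewrite -(ltn_pmul2l (isT : 0 < 4)).
by case: (i == 0) g0 g1 => /=; lia.
Qed.

Lemma genus_count_decr n i : 44 <= n -> n < 3 * i -> i.*2 < n ->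
  genus_count n.+1 i.+1 < genus_count n.+1 i.
Proof.
move=> n44 n3i i2n; pose m := n.+1 - i.*2.
have nE : n.+1 = i.*2 + m by rewrite /m; lia.
have mi : m <= i by rewrite /m; lia.
have m2 : 2 <= m by rewrite /m; lia.
have u := ucoef_decr nE ltac:(lia) mi.
have X0 := fibc_gt0 nE.
have nE' : n.+1 = (i.+1).*2 + (m - 2) by lia.
have r0 := fibc_predE nE; have r1 := fibc_succE nE ltac:(lia).
have r2 := fibc_predE nE'.
have r3 : i.+2 * fibc n.+1 i.+2 = (m - 3) * fibc n i.+1.
  case: (ltnP 0 (m - 2)) => [m3|m3]; first by rewrite (fibc_succE nE') //; congr (_ * _); lia.
  by have -> : m - 3 = 0 by [lia]; rewrite fibc_small ?muln0 //; lia.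
have g0 := genus_countE n i; have g1 := genus_countE n i.+1.
have E : 2 ^ (n.+1 + i).+1 = 8 ^ i * 2 ^ m.+1.
  by rewrite -[8]/(2 ^ 3) -expnM -expnD; congr (_ ^ _); lia.
have E' : 2 ^ (n.+1 + i.+1).+1 = 2 * (8 ^ i * 2 ^ m.+1) by rewrite -E -expnS; congr (_ ^ _); lia.
move: u; rewrite {}E in g0; rewrite {}E' expnS in g1; move: g0 g1.
have -> : ucoef n i.+1 = 2 * fibc n.+1 i.+1 + fibc n i by [].
have -> : (i == 0) = false by lia.
move: (ucoef n i) (fibc n.+1 i) X0 (fibc n.+1 i.+1) (fibc n i) (fibc n.+1 i.+2)
  (fibc n i.+1) r0 r1 r2 r3.
move=> u X X0 x1 z x2 z1 r0 r1 r2 r3.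
have P8 : 0 < 8 ^ i by rewrite expn_gt0.
move: (8 ^ i) P8 => G G0 g0 g1 uu.
have B2 : 2 <= 2 ^ m.+1 by rewrite expnS leq_pmulr // expn_gt0.
(* The desired inequality, multiplied by 4 and divided by [8 ^ i]. *)
suff main : 128 * x2 + 64 * z1 + u + 2 ^ m.+1 * (2 * (2 * x1 + z)) <
    2 ^ m.+1 * u + 32 * x1 + 16 * z.
  move: main; rewrite -(ltn_pmul2l G0) => main.
  rewrite -(ltn_pmul2l (isT : 0 < 4)).
  by move: (2 ^ m.+1) g0 g1 main => B; lia.
set v := 2 * (2 * x1 + z) in uu *.
have vu : v < u.
  rewrite -(ltn_pmul2l (isT : 0 < n.+3)); apply: leq_trans uu.
  by rewrite -[X in X < _]addn0 ltn_add2l muln_gt0 X0.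
have [k mE] : exists k, m = k.+2 by exists (m - 2); lia.
(* With ratio 7/32 the terms [128 * x2 + 64 * z1] are at most [7 * v], while the right-hand side of
   the claim offers [8 * v]. What remains is [v < u] multiplied by [2 ^ m.+1 - 1]. *)
have [near|far] := leqP (32 * (m * (m - 1))) (7 * ((i + m) * i.+1)).
  have h1 : 32 * x2 <= 7 * x1.
    apply: (@ratio_leq ((m - 3) * (m - 2)) (i.+2 * (i.+1 + (m - 2)))).
    - by rewrite [RHS]mulnAC r3 -[LHS]mulnA -r2; lia.
    - by rewrite muln_gt0.
    have a1 : (m - 3) * (m - 2) <= m * (m - 1) by apply: leq_mul; lia.
    have a2 : (i + m) * i.+1 <= i.+2 * (i.+1 + (m - 2)) by rewrite mE !subSS subn0; lia.
    by apply: leq_trans (leq_trans near _); rewrite leq_mul2l.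
  have h2 : 32 * z1 <= 7 * z.
    apply: (@ratio_leq ((m - 2) * (m - 1)) (i.+1 * (i.+1 + (m - 2)))).
    - by rewrite -[RHS]mulnA r2 [RHS]mulnCA r1 -[LHS]mulnA subn1.
    - by rewrite muln_gt0.
    have im0 : 0 < i + m by lia.
    rewrite -(leq_pmul2r im0).
    have near' : 32 * (m * (m - 1)) * (i.+1 + (m - 2)) <=
           7 * ((i + m) * i.+1) * (i.+1 + (m - 2)) by rewrite leq_mul2r near orbT.
    apply: leq_trans (leq_trans near' _); last by rewrite mE; lia.
    rewrite -!(mulnA 32) leq_mul2l /=.
    have : k * (i + k.+2) * k.+1 <= k.+2 * (i.+1 + k) * k.+1.
      by rewrite leq_mul2r; apply/orP; right; lia.
    by rewrite mE !subSS !subn0; lia.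
  have : (2 ^ m.+1).-1 * v < (2 ^ m.+1).-1 * u by rewrite ltn_pmul2l //; lia.
  by move: (2 ^ m.+1) B2 => [|B] //=; rewrite /v; lia.
(* In the other case [m] is at least about a fifth of [n], so [2 ^ m.+1] is much larger than [n]. *)
have i2m : i < m.*2.
  rewrite ltnNge; apply/negP => mi2.
  have : (m.*2 + m) * m.*2.+1 <= (i + m) * i.+1 by apply: leq_mul; lia.
  by move: far; rewrite mE; lia.
(* These give 128 x2 + 64 z1 <= 192 z1 <= 96 x1 <= 96 z <= 48 X, and 48 X is below the surplus 6 X
   (2^(m+1) - 1) / (n + 3) from [ucoef_decr] by [Bm]. *)
have h0 : 1 * x1 <= 1 * z by apply: (ratio_leq (esym r1)); lia.
have h1 : 2 * z <= 1 * X by apply: (ratio_leq (esym r0)); lia.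
have h2 : 2 * z1 <= 1 * x1 by apply: (ratio_leq (esym r2)); lia.
have h3 : 1 * x2 <= 1 * z1 by apply: (ratio_leq (esym r3)); lia.
have Bm : 8 * n.+3 < (2 ^ m.+1).-1.
  have : 40 * m + 17 < 2 ^ m.+1; last by lia.
  have : 9 <= m by lia.
  elim: (m) => // j IH; rewrite leq_eqVlt => /orP[/eqP<- //|j9].
  by have := IH j9; rewrite [2 ^ j.+2]expnS; lia.
move: (2 ^ m.+1) B2 Bm => [|B] //= _ Bm.
have e1 : B * (n.+3 * v) + B * (6 * X) <= B * (n.+3 * u) by rewrite -mulnDr leq_mul2l uu orbT.
have e2 : 8 * n.+3 * (6 * X) < B * (6 * X) by rewrite ltn_pmul2r // muln_gt0.
have : n.+3 * (B * v + 48 * X) < n.+3 * (B * u) by lia.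
by rewrite ltn_pmul2l // /v; lia.
Qed.

(** * The first rows *)

(* Binary numbers, since these coefficients are too large for nat to evaluate. *)
Fixpoint add_coefs (u v : seq N) : seq N :=
  match u, v with
  | a :: u', b :: v' => N.add a b :: add_coefs u' v'
  | [::], _ => v
  | _, [::] => u
  end.

Lemma nth_add_coefs u v i :
  N.to_nat (nth N0 (add_coefs u v) i) = N.to_nat (nth N0 u i) + N.to_nat (nth N0 v i).
Proof. by elim: u v i => [|a u IH] [|b v] [|i] //=; rewrite ?nth_nil ?addn0 //; lia. Qed.

Definition double_coefs (u : seq N) := add_coefs u u.

(** The lists belong to states 0, 1 and 2 together, 3, 4 and 5; a leading [N0] raises the genus by
    one. *)
Definition rows_step (r : seq N * seq N * seq N * seq N * seq N) :=
  let: (c, t, s, e, d) := r in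
  (add_coefs c (double_coefs (N0 :: t)), double_coefs (add_coefs c (N0 :: e)),
   add_coefs (add_coefs c (double_coefs s)) (add_coefs (N0 :: e) (double_coefs (double_coefs d))),
   add_coefs e (double_coefs t), double_coefs (N0 :: s)).

Definition rows n := iter n rows_step ([:: Npos xH], [::], [::], [::], [::]).

Definition row n :=
  let: (c, t, s, e, d) := rows n in add_coefs c (add_coefs t (add_coefs s (add_coefs e d))).

Lemma rowsP n i : let: (c, t, s, e, d) := rows n in
  [/\ N.to_nat (nth N0 c i) = state_count n 0 i,
      N.to_nat (nth N0 t i) = state_count n 1 i + state_count n 2 i,
      N.to_nat (nth N0 s i) = state_count n 3 i,
      N.to_nat (nth N0 e i) = state_count n 4 i &
      N.to_nat (nth N0 d i) = state_count n 5 i].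
Proof.
elim: n i => [|n IH] i.
  by rewrite !state_count0 /=; case: i => [|i]; rewrite /= ?nth_nil.
rewrite /rows iterS -/(rows n) /rows_step; move: IH; case: (rows n) => [[[[c t] s] e] d] IH.
have [h0 h12 h3 h4 h5] := state_countS n i; have [c1 t1 s1 e1 d1] := IH i.
rewrite h0 h12 h3 h4 h5 /double_coefs !nth_add_coefs.
case: i h0 h12 h3 h4 h5 c1 t1 s1 e1 d1 => [|i] h0 h12 h3 h4 h5 c1 t1 s1 e1 d1 /=.
  by split; lia.
have [c2 t2 s2 e2 d2] := IH i.
by split; lia.
Qed.

Lemma rowP n i : 0 < n -> N.to_nat (nth N0 (row n) i) = genus_count n i.
Proof.
move=> n0; rewrite genus_count_states //; have := rowsP n i; rewrite /row.
case: (rows n) => [[[[c t] s] e] d] [] *; rewrite !nth_add_coefs; lia.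
Qed.

Definition peak_check n :=
  let r := row n in
  all (fun i => if i < p3 n then N.ltb (nth N0 r i) (nth N0 r i.+1)
                else N.ltb (nth N0 r i.+1) (nth N0 r i)) (iota 0 n./2).

Lemma peak_check_small : all peak_check (iota 1 44).
Proof. by vm_compute. Qed.

Lemma genus_count_peak n i : 0 < n -> i < n./2 ->
  if i < p3 n then genus_count n i < genus_count n i.+1
  else genus_count n i.+1 < genus_count n i.
Proof.
move=> n0 i_n; have [n45|n45] := ltnP n 45.
  have nI : n \in iota 1 44 by rewrite mem_iota n0.
  have := allP peak_check_small n nI; rewrite /peak_check => /allP/(_ i).
  rewrite mem_iota add0n i_n => /(_ isT).
  by rewrite -(rowP i n0) -(rowP i.+1 n0); case: ifP => _ /N.ltb_lt; lia.
case: n n0 n45 i_n => // n _ n45 i_n.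
have -> : p3 n.+1 = (n.+1 + 2) %/ 3.
  by rewrite /p3; do 2 (case: ifP => [|_]; first lia).
case: ifP => ip; first by apply: genus_count_incr; lia.
by apply: genus_count_decr; lia.
Qed.

Lemma p3_half n : p3 n <= n./2.
Proof. by rewrite /p3; case: ifP => ?; last case: ifP => ?; lia. Qed.

Lemma genus_count_gt0 n i : 0 < n -> i <= n./2 -> 0 < genus_count n i.
Proof.
case: n => // n _ i_n.
have x0 : 0 < fibc n.+1 i by rewrite /fibc bin_gt0; lia.
have u0 : 0 < ucoef n i by rewrite /ucoef; lia.
have h : 8 ^ i < 2 ^ (n.+1 + i).+1.
  by rewrite -[8]/(2 ^ 3) -expnM ltn_exp2l //; lia.
have : 8 ^ i * ucoef n i < 2 ^ (n.+1 + i).+1 * ucoef n i by rewrite ltn_pmul2r.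
by have := genus_countE n i; lia.
Qed.

Lemma genus_count_eq0 n i : 0 < n -> n./2 < i -> genus_count n i = 0.
Proof.
case: n => // n _ ni; have := genus_countE n i.
rewrite /ucoef (@fibc_small n.+1 i.+1) ?(@fibc_small n.+1 i) ?(@fibc_small n i); try lia.
have -> : (i == 0) = false by lia.
case: i ni => // i ni; rewrite /shift !muln0 !addn0 add0n.
(* Just above the range, [ucoef] can be nonzero, but then the two powers in front of it coincide and
   cancel. *)
have [e|e] := eqVneq i.*2 n; last by rewrite fibc_small; lia.
have -> : 2 ^ (n.+1 + i.+1).+1 = 8 ^ i.+1.
  by rewrite -[8]/(2 ^ 3) -expnM; congr (_ ^ _); lia.
by lia.
Qed.

Theorem theorem3p9 (n : nat) (hn : 1 <= n) :
  exists q r : nat,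
    is_min_genus n q /\ is_max_genus n r /\
    unimodal (genus_count n) q r /\ is_peak (genus_count n) q r (p3 n).
Proof.
have realised i : 0 < genus_count n i <-> exists K T, has_genus (@ladder_word n K T) i.
  rewrite card_gt0; split=> [/set0Pn[[K T]]|[K [T g]]]; first by rewrite inE; exists K, T.
  by apply/set0Pn; exists (K, T); rewrite inE.
have peak : is_peak (genus_count n) 0 n./2 (p3 n).
  have ph := p3_half n.
  split=> [|i _ ip|p0|i|pr|i pi ir].
  - by rewrite leqnn ph.
  - have := @genus_count_peak n i hn; rewrite (ltnW ip) => H; apply/ltnW/H; lia.
  - have := @genus_count_peak n (p3 n).-1 hn; rewrite prednK // leqnn; apply; lia.
  - by rewrite -eqn_leq => /eqP->.
  - by have := @genus_count_peak n (p3 n) hn pr; rewrite ltnn.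
  by have := @genus_count_peak n i hn ir; rewrite ltnNge (ltnW pi) => /ltnW.
exists 0, n./2; split; [|split; [|split]] => //.
- by split=> //; apply/realised/genus_count_gt0.
- split=> [|K T g hg]; first exact/realised/genus_count_gt0.
  rewrite leqNgt; apply/negP => /(genus_count_eq0 hn) g0.
  by have : 0 < genus_count n g; [apply/realised; exists K, T | rewrite g0].
by exists (p3 n), (p3 n).
Qed.
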